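(* Consider the fully discrete scheme with constant time step $\Delta t>0$ $$ \begin{bmatrix} \mathbf{M}^{\mathbf{q}} & 0 \\ 0 & \mathbf{M}^{\mathbf{e}} \end{bmatrix} \begin{pmatrix} \mathbf{q}_{n+1}-\mathbf{q}_n \\ \mathbf{e}_{n+1}-\mathbf{e}_n \end{pmatrix} = \Delta t \begin{bmatrix} 0 & \mathbf{P}(\boldsymbol{\theta}_{n+1/2}) \\ -\mathbf{P}^\top(\boldsymbol{\theta}_{n+1/2}) & \mathbf{J}(\mathbf{e}_{n+1/2},\boldsymbol{\theta}_{n+1/2}) \end{bmatrix} \begin{pmatrix} \mathbf{z}_{\mathbf{q}} \\ \mathbf{e}_{n+1/2} \end{pmatrix} + \Delta t \begin{bmatrix} 0 \\ \mathbf{B}^{\mathbf{e}} \end{bmatrix}\mathbf{u}_{n+1/2}, $$ where $\mathbf{x}_{n+1/2}:=\tfrac12(\mathbf{x}_n+\mathbf{x}_{n+1})$ for $\mathbf{x}\in\{\mathbf{q},\mathbf{e},\boldsymbol{\theta}\}$, $\mathbf{u}_{n+1/2}$ is a given input vector, and all matrices and vectors are as described in the context. Let $\mathbf{x}_n=(\mathbf{q}_n,\mathbf{e}_n)$ and $\mathbf{x}_{n+1}=(\mathbf{q}_{n+1},\mathbf{e}_{n+1})$ satisfy this scheme, and define the discrete energy $$ H(\mathbf{x}_n)=\tfrac12\,\mathbf{e}_n^\top\mathbf{M}^{\mathbf{e}}\mathbf{e}_n+\rho g A\,\mathbf{a}^\top\mathbf{r}_{y,n}. $$ Then: (i) if $\mathbf{u}_{n+1/2}=0$,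 the discrete energy is preserved: $H(\mathbf{x}_{n+1})=H(\mathbf{x}_n)$; (ii) for a general input $\mathbf{u}_{n+1/2}$, the discrete power balance $$ \frac{H(\mathbf{x}_{n+1})-H(\mathbf{x}_n)}{\Delta t}=\mathbf{y}_{n+1/2}^\top\mathbf{u}_{n+1/2},\qquad \mathbf{y}_{n+1/2}:=(\mathbf{B}^{\mathbf{e}})^\top\mathbf{e}_{n+1/2}, $$ holds.
   Context: The scheme is the implicit midpoint discretization of a multibody system made of finitely many planar geometrically exact beams (possibly just one), each discretized in space by finite elements, under gravity. The constants $\rho$ (mass density), $A$ (cross-section area), $g$ (gravity acceleration) are real constants. Unknowns: $\mathbf{q}=(\mathbf{r}_x,\mathbf{r}_y,\boldsymbol{\theta})$ collects the degrees of freedom of the horizontal and vertical centerline positions and of the cross-section angles of all beams (concatenated over the beams). The vector $\mathbf{e}=(\mathbf{v},\mathbf{w},\mathbf{n},\mathbf{m})$ collects the degrees of freedom of the material linear velocities, angular velocities, stress resultants and bending moments. $\mathbf{r}_{y,n}$ and $\boldsymbol{\theta}_n$ denote the corresponding blocks of $\mathbf{q}_n$. Finite element bases: a beam of length $L$ occupies $\Omega=[0,L]$, divided uniformly into $N_{\mathrm{el}}$ elements of size $h=L/N_{\mathrm{el}}$. Let $\varphi_1,\dots,\varphi_{N_{\mathrm{el}}+1}$ be the continuous piecewise linear nodal (Lagrange) basis functions, and let $\chi_1,\dots,\chi_{N_{\mathrm{el}}}$ be the indicator functions of the elements. For each beam, the components of the centerline position and of the material velocity are expanded in a basis collected in the row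 vector $\boldsymbol{\xi}_r$, which is either $[\varphi_1\ \dots\ \varphi_{N_{\mathrm{el}}+1}]$ or $[\chi_1\ \dots\ \chi_{N_{\mathrm{el}}}]$. The angle and the angular velocity are likewise expanded in a row vector $\boldsymbol{\xi}_\theta$ that is one of these two. Matrices and vectors (for several beams, those built beam by beam are concatenated, respectively block-diagonally concatenated, over the beams): - $\mathbf{M}^{\mathbf{q}}=\mathrm{Diag}(\mathbf{M}^{\mathbf{r}_x},\mathbf{M}^{\mathbf{r}_y},\mathbf{M}^{\theta})$ with $\mathbf{M}^{\mathbf{r}_x}=\mathbf{M}^{\mathbf{r}_y}=\int_\Omega\boldsymbol{\xi}_r^\top\boldsymbol{\xi}_r\,\mathrm{d}s$ and $\mathbf{M}^\theta=\int_\Omega\boldsymbol{\xi}_\theta^\top\boldsymbol{\xi}_\theta\,\mathrm{d}s$. - $\mathbf{M}^{\mathbf{e}}$ is a constant symmetric positive definite matrix. - $\mathbf{a}=\int_\Omega\boldsymbol{\xi}_r^\top\,\mathrm{d}s$. Since the basis functions in $\boldsymbol{\xi}_r$ sum to one (almost everywhere), $\mathbf{M}^{\mathbf{r}_y}\mathbf{1}=\mathbf{a}$, where $\mathbf{1}=(1,\dots,1)^\top$. - $\mathbf{z}_{\mathbf{q}}=\rho A g\,(0,\mathbf{1},0)$, partitioned as $\mathbf{q}=(\mathbf{r}_x,\mathbf{r}_y,\boldsymbol{\theta})$, is the constant gravity vector. - $\mathbf{P}(\boldsymbol{\theta})=\begin{bmatrix}\mathbf{R}(\boldsymbol{\theta})&0&0&0\\0&\mathbf{M}^\theta&0&0\end{bmatrix}$,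 with columns partitioned as $\mathbf{e}=(\mathbf{v},\mathbf{w},\mathbf{n},\mathbf{m})$ and rows as $((\mathbf{r}_x,\mathbf{r}_y),\boldsymbol{\theta})$. Here $\mathbf{R}(\boldsymbol{\theta})=\int_\Omega(\mathbf{I}_2\otimes\boldsymbol{\xi}_r)^\top\boldsymbol{\Lambda}(\boldsymbol{\xi}_\theta\boldsymbol{\theta})(\mathbf{I}_2\otimes\boldsymbol{\xi}_r)\,\mathrm{d}s$ and $\boldsymbol{\Lambda}(\vartheta)=\begin{bmatrix}\cos\vartheta&-\sin\vartheta\\ \sin\vartheta&\cos\vartheta\end{bmatrix}$. - $\mathbf{J}(\mathbf{e},\boldsymbol{\theta})=-\mathbf{J}^\top(\mathbf{e},\boldsymbol{\theta})$ is a skew-symmetric matrix depending on the state. It is the sum $\mathbf{J}^{\mathbf{e}}(\mathbf{e})+\mathbf{J}^{\mathrm{int}}(\boldsymbol{\theta})$ of the block-diagonal concatenation of the skew-symmetric matrices of the individual beams and a skew-symmetric coupling matrix. - $\mathbf{B}^{\mathbf{e}}$ is a constant input matrix. *)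

(* Defs.v *)
From HB Require Import structures.
From mathcomp Require Import all_boot all_order all_algebra.
From mathcomp Require Import all_classical all_reals all_analysis.

Set Implicit Arguments.
Unset Strict Implicit.
Unset Printing Implicit Defensive.

Import Order.TTheory GRing.Theory Num.Theory numFieldNormedType.Exports.

Local Open Scope ring_scope.
Local Open Scope classical_set_scope.

Definition mx_integral {R : realType} {m n : nat} (D : set R)
    (F : R -> 'M[R]_(m, n)) : 'M[R]_(m, n) :=
  \matrix_(i, j) \int[lebesgue_measure]_(s in D) F s i j.

Definition sympos {R : realType} {n : nat} (M : 'M[R]_n) : Prop :=
  M = M^T /\ forall x : 'cV[R]_n, x != 0 -> 0 < (x^T *m M *m x) 0 0.

Definition midpoint {R : realType} {n : nat} (x y : 'cV[R]_n) : 'cV[R]_n :=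
  2^-1 *: (x + y).

(* Same encoding as [\mxdiag], but with possibly rectangular blocks: the block
   at (i, j) with i = j has the size of B i, so [conform_mx] only acts there as
   a cast. *)
Definition mxdiag_rect {R : realType} {k : nat} {p q : 'I_k -> nat}
    (B : forall b, 'M[R]_(p b, q b)) : 'M[R]_(\sum_b p b, \sum_b q b) :=
  \mxblock_(i < k, j < k) (if i == j then conform_mx 0 (B i) else 0).

Variant fe_kind := PiecewiseLinear | PiecewiseConstant.

(* The linear basis is indexed by the N + 1 nodes s_i = i h, and the constant
   one by the N elements [s_j, s_(j+1)], with indices starting from 0. *)
Definition fe_dim (kind : fe_kind) (N : nat) : nat :=
  match kind with PiecewiseLinear => N.+1 | PiecewiseConstant => N end.

Definition hat {R : realType} (h : R) (i : nat) (s : R) : R :=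
  Num.max 0 (1 - `|s - i%:R * h| / h).

Definition element_indic {R : realType} (h : R) (j : nat) (s : R) : R :=
  \1_(`[j%:R * h, j.+1%:R * h]) s.

Definition fe_basis {R : realType} (kind : fe_kind) (L : R) (N : nat) (s : R) :
    'rV[R]_(fe_dim kind N) :=
  match kind as c return 'rV[R]_(fe_dim c N) with
  | PiecewiseLinear => \row_i hat (L / N%:R) i s
  | PiecewiseConstant => \row_j element_indic (L / N%:R) j s
  end.

(* dim_n and dim_m are the numbers of degrees of freedom of the stress
   resultants and of the bending moment, whose bases are left unspecified. *)
Record beam (R : realType) := Beam {
  len : R;
  nel : nat;
  kind_r : fe_kind;
  kind_theta : fe_kind;
  dim_n : nat;
  dim_m : nat }.

Definition wf_beam {R : realType} (b : beam R) : Prop :=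
  0 < len b /\ (0 < nel b)%N.

Section Beam.
Context {R : realType}.
Variable b : beam R.

Definition dim_r : nat := fe_dim (kind_r b) (nel b).
Definition dim_theta : nat := fe_dim (kind_theta b) (nel b).
Definition dim_v : nat := (dim_r + dim_r)%N.
Definition dim_eb : nat := ((dim_v + dim_theta) + (dim_n b + dim_m b))%N.

Definition Omega : set R := `[0, len b].

Definition xi_r : R -> 'rV[R]_dim_r := fe_basis (kind_r b) (len b) (nel b).
Definition xi_theta : R -> 'rV[R]_dim_theta :=
  fe_basis (kind_theta b) (len b) (nel b).

Definition mass_r : 'M[R]_dim_r :=
  mx_integral Omega (fun s => (xi_r s)^T *m xi_r s).
Definition mass_theta : 'M[R]_dim_theta :=
  mx_integral Omega (fun s => (xi_theta s)^T *m xi_theta s).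
Definition avec_beam : 'cV[R]_dim_r := mx_integral Omega (fun s => (xi_r s)^T).

(* The Kronecker product of I_2 with xi_r. *)
Definition I2_xi_r (s : R) : 'M[R]_(1 + 1, dim_v) :=
  block_mx (xi_r s) 0 0 (xi_r s).

Definition Lambda (t : R) : 'M[R]_(1 + 1) :=
  block_mx (cos t)%:M (- sin t)%:M (sin t)%:M (cos t)%:M.

Definition Rmx_beam (theta : 'cV[R]_dim_theta) : 'M[R]_dim_v :=
  mx_integral Omega (fun s =>
    (I2_xi_r s)^T *m Lambda ((xi_theta s *m theta) 0 0) *m I2_xi_r s).

End Beam.

(* Degrees of freedom of the multibody system:
   q = ((r_x, r_y), theta) and e = ((v, w), (n, m)), where each of r_x, r_y,
   theta, v, w, n, m is the concatenation over the beams. *)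
Section System.
Context {R : realType} {k : nat}.
Variable bs : 'I_k -> beam R.

Definition dimR : nat := (\sum_(b < k) dim_r (bs b))%N.
Definition dimTheta : nat := (\sum_(b < k) dim_theta (bs b))%N.
Definition dimV : nat := (\sum_(b < k) dim_v (bs b))%N.
Definition dimN : nat := (\sum_(b < k) dim_n (bs b))%N.
Definition dimM : nat := (\sum_(b < k) dim_m (bs b))%N.
Definition dimQ : nat := ((dimR + dimR) + dimTheta)%N.
Definition dimE : nat := ((dimV + dimTheta) + (dimN + dimM))%N.

Definition ry_of (q : 'cV[R]_dimQ) : 'cV[R]_dimR := dsubmx (usubmx q).
Definition theta_of (q : 'cV[R]_dimQ) : 'cV[R]_dimTheta := dsubmx q.

Definition Mr : 'M[R]_dimR := \mxdiag_(b < k) mass_r (bs b).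
Definition Mtheta : 'M[R]_dimTheta := \mxdiag_(b < k) mass_theta (bs b).
Definition Mq : 'M[R]_dimQ := block_mx (block_mx Mr 0 0 Mr) 0 0 Mtheta.

Definition avec : 'cV[R]_dimR := \mxcol_(b < k) avec_beam (bs b).

Definition zq (rho A g : R) : 'cV[R]_dimQ :=
  (rho * A * g) *: col_mx (col_mx 0 (const_mx 1)) 0.

(* Since r_x and r_y are concatenated separately, the r_x-rows and the r_y-rows
   of the beam matrices are collected into two block-diagonal matrices. *)
Definition Rmx (theta : 'cV[R]_dimTheta) : 'M[R]_(dimR + dimR, dimV) :=
  col_mx
    (mxdiag_rect (fun b => usubmx (Rmx_beam (submxcol theta b))))
    (mxdiag_rect (fun b => dsubmx (Rmx_beam (submxcol theta b)))).

Definition Pmx (theta : 'cV[R]_dimTheta) : 'M[R]_(dimQ, dimE) :=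
  row_mx (block_mx (Rmx theta) 0 0 Mtheta) 0.

Definition e_beam (e : 'cV[R]_dimE) (b : 'I_k) : 'cV[R]_(dim_eb (bs b)) :=
  col_mx
    (col_mx (submxcol (usubmx (usubmx e)) b) (submxcol (dsubmx (usubmx e)) b))
    (col_mx (submxcol (usubmx (dsubmx e)) b) (submxcol (dsubmx (dsubmx e)) b)).

(* Block-diagonal concatenation over the beams, in the ordering of e: each of
   the 4 x 4 blocks (v, w, n, m) is block-diagonal over the beams. *)
Definition ediag (B : forall b, 'M[R]_(dim_eb (bs b))) : 'M[R]_dimE :=
  block_mx
    (block_mx (mxdiag_rect (fun b => ulsubmx (ulsubmx (B b))))
              (mxdiag_rect (fun b => ursubmx (ulsubmx (B b))))
              (mxdiag_rect (fun b => dlsubmx (ulsubmx (B b))))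
              (mxdiag_rect (fun b => drsubmx (ulsubmx (B b)))))
    (block_mx (mxdiag_rect (fun b => ulsubmx (ursubmx (B b))))
              (mxdiag_rect (fun b => ursubmx (ursubmx (B b))))
              (mxdiag_rect (fun b => dlsubmx (ursubmx (B b))))
              (mxdiag_rect (fun b => drsubmx (ursubmx (B b)))))
    (block_mx (mxdiag_rect (fun b => ulsubmx (dlsubmx (B b))))
              (mxdiag_rect (fun b => ursubmx (dlsubmx (B b))))
              (mxdiag_rect (fun b => dlsubmx (dlsubmx (B b))))
              (mxdiag_rect (fun b => drsubmx (dlsubmx (B b)))))
    (block_mx (mxdiag_rect (fun b => ulsubmx (drsubmx (B b))))
              (mxdiag_rect (fun b => ursubmx (drsubmx (B b))))
              (mxdiag_rect (fun b => dlsubmx (drsubmx (B b))))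
              (mxdiag_rect (fun b => drsubmx (drsubmx (B b))))).

Definition Jmx (Je : forall b, 'cV[R]_(dim_eb (bs b)) -> 'M[R]_(dim_eb (bs b)))
    (Jint : 'cV[R]_dimTheta -> 'M[R]_dimE)
    (e : 'cV[R]_dimE) (theta : 'cV[R]_dimTheta) : 'M[R]_dimE :=
  ediag (fun b => Je b (e_beam e b)) + Jint theta.

Definition energy (rho A g : R) (Me : 'M[R]_dimE)
    (q : 'cV[R]_dimQ) (e : 'cV[R]_dimE) : R :=
  2^-1 * (e^T *m Me *m e) 0 0 + rho * g * A * (avec^T *m ry_of q) 0 0.

Definition midpoint_scheme (rho A g dt : R) (Me : 'M[R]_dimE)
    (J : 'cV[R]_dimE -> 'cV[R]_dimTheta -> 'M[R]_dimE)
    (nu : nat) (Be : 'M[R]_(dimE, nu)) (u : 'cV[R]_nu)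
    (q0 : 'cV[R]_dimQ) (e0 : 'cV[R]_dimE)
    (q1 : 'cV[R]_dimQ) (e1 : 'cV[R]_dimE) : Prop :=
  let eh := midpoint e0 e1 in
  let thetah := midpoint (theta_of q0) (theta_of q1) in
  block_mx Mq 0 0 Me *m col_mx (q1 - q0) (e1 - e0) =
    dt *: (block_mx 0 (Pmx thetah) (- (Pmx thetah)^T) (J eh thetah)
             *m col_mx (zq rho A g) eh)
    + dt *: (col_mx 0 Be *m u).

End System.

(* Main.v *)
Require Import Defs.
From mathcomp Require Import all_boot all_order all_algebra.
From mathcomp Require Import all_classical all_reals all_analysis.
From mathcomp Require Import measurable_realfun ring lra.

(** The midpoint rule is exact on quadratic functions: for symmetric Me, the
    kinetic and elastic energy changes over one step by exactly
    e_mid^T Me (e1 - e0), where e_mid is the midpoint of e0 and e1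
    ([quadratic_energy_diff]).  The gravity energy is linear in r_y, and its
    change is z^T Mq (q1 - q0), because the gravity vector z is constant
    with value rho A g on the r_y-block and Mr maps the all-ones vector to
    the vector a of the energy ([gravity_energy_diff]).  The total change of
    energy is thus the pairing of (z, e_mid) with the left-hand side of the
    scheme.  Substituting the right-hand side, the terms in P and -P^T cancel,
    the term in J vanishes since J is skew-symmetric, and dt e_mid^T Be u
    remains ([block_power_balance]).

    Two facts about the discretization are used.  First, J is skew-symmetric
    because concatenation over the beams commutes with transposition
    ([Jmx_skew]).  Second, Mr 1 = a, because the finite element basis functions
    sum to one outside the nodes ([fe_basis_sum1_ae]), so that summing a row of
    the Gram matrix gives the integral of a single basis function
    ([gram_mul_ones]).  The partition of unity is obtained by telescoping: each
    basis function is the difference of two consecutive translates of one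
    function rising from 0 to 1, namely a clipped ramp for the hat functions
    and a step for the indicators. *)

Set Implicit Arguments.
Unset Strict Implicit.
Unset Printing Implicit Defensive.

Import Order.TTheory GRing.Theory Num.Theory numFieldNormedType.Exports.

Local Open Scope ring_scope.

(** * Skew-symmetry of the concatenated structure matrix *)

Lemma tr_mxdiag_rect (R : realType) (k : nat) (p q : 'I_k -> nat)
    (B : forall b, 'M[R]_(p b, q b)) :
  (mxdiag_rect B)^T = mxdiag_rect (fun b => (B b)^T).
Proof.
rewrite /mxdiag_rect tr_mxblock; apply: eq_mxblock => i j.
rewrite eq_sym; case: (eqVneq i j) => [->|_]; last exact: trmx0.
by rewrite !conform_mx_id.
Qed.

Lemma opp_mxdiag_rect (R : realType) (k : nat) (p q : 'I_k -> nat)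
    (B : forall b, 'M[R]_(p b, q b)) :
  mxdiag_rect (fun b => - B b) = - mxdiag_rect B.
Proof.
rewrite /mxdiag_rect -mxblockN; apply: eq_mxblock => i j.
case: (eqVneq i j) => [->|_]; last by rewrite oppr0.
by rewrite !conform_mx_id.
Qed.

Lemma eq_mxdiag_rect (R : realType) (k : nat) (p q : 'I_k -> nat)
    (B C : forall b, 'M[R]_(p b, q b)) :
  (forall b, B b = C b) -> mxdiag_rect B = mxdiag_rect C.
Proof. by move=> eqBC; congr mxdiag_rect; apply: functional_extensionality_dep. Qed.

(** Reduces an equality between two [ediag] to equalities of their sixteen
    blocks without comparing the dimensions, which are big sums. *)
Lemma eq_block_mx (R : Type) (m1 m2 n1 n2 : nat)
    (A A' : 'M[R]_(m1, n1)) (B B' : 'M[R]_(m1, n2))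
    (C C' : 'M[R]_(m2, n1)) (D D' : 'M[R]_(m2, n2)) :
  A = A' -> B = B' -> C = C' -> D = D' ->
  block_mx A B C D = block_mx A' B' C' D'.
Proof. by move=> -> -> -> ->. Qed.

Lemma tr_ediag (R : realType) (k : nat) (bs : 'I_k -> beam R)
    (B : forall b, 'M[R]_(dim_eb (bs b))) :
  (ediag B)^T = ediag (fun b => (B b)^T).
Proof.
rewrite /ediag !tr_block_mx !tr_mxdiag_rect.
apply: eq_block_mx; apply: eq_block_mx; apply: eq_mxdiag_rect => b;
  by rewrite !(trmx_ulsub, trmx_ursub, trmx_dlsub, trmx_drsub).
Qed.

Lemma opp_ediag (R : realType) (k : nat) (bs : 'I_k -> beam R)
    (B : forall b, 'M[R]_(dim_eb (bs b))) :
  ediag (fun b => - B b) = - ediag B.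
Proof.
rewrite /ediag !opp_block_mx -!opp_mxdiag_rect.
apply: eq_block_mx; apply: eq_block_mx; apply: eq_mxdiag_rect => b;
  by apply/matrixP => i j; rewrite !mxE.
Qed.

Lemma Jmx_skew (R : realType) (k : nat) (bs : 'I_k -> beam R)
    (Je : forall b : 'I_k, 'cV[R]_(dim_eb (bs b)) -> 'M[R]_(dim_eb (bs b)))
    (Jint : 'cV[R]_(dimTheta bs) -> 'M[R]_(dimE bs)) e theta :
  (forall b eb, Je b eb = - (Je b eb)^T) ->
  (forall theta, Jint theta = - (Jint theta)^T) ->
  (Jmx Je Jint e theta)^T = - Jmx Je Jint e theta.
Proof.
move=> Je_skew Jint_skew.
have Jint_tr : (Jint theta)^T = - Jint theta by rewrite {2}Jint_skew opprK.
have Je_tr : (fun b => (Je b (e_beam e b))^T) = (fun b => - Je b (e_beam e b)).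
  by apply: functional_extensionality_dep => b; rewrite {2}Je_skew opprK.
by rewrite /Jmx linearD /= tr_ediag Je_tr opp_ediag Jint_tr -opprD.
Qed.

(** * Quadratic forms and the abstract power balance *)

Lemma skew_quadratic_form0 (R : realType) (n : nat) (J : 'M[R]_n) (x : 'cV[R]_n) :
  J^T = - J -> x^T *m J *m x = 0.
Proof.
move=> J_skew; have: x^T *m J *m x = - (x^T *m J *m x).
  rewrite [LHS]mx11_scalar -tr_scalar_mx -mx11_scalar !trmx_mul trmxK.
  by rewrite J_skew mulNmx mulmxN mulmxA.
move/eqP; rewrite -subr_eq0 opprK -mulr2n -scaler_nat scaler_eq0 pnatr_eq0.
by move=> /eqP.
Qed.

(** With M symmetric, the mixed terms of (x + y)^T M (y - x) cancel; this is
    the discrete chain rule that singles out the midpoint. *)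
Lemma quadratic_energy_diff (R : realType) (n : nat) (M : 'M[R]_n) (x y : 'cV[R]_n) :
  M = M^T ->
  2^-1 * (y^T *m M *m y) 0 0 - 2^-1 * (x^T *m M *m x) 0 0 =
  ((midpoint x y)^T *m (M *m (y - x))) 0 0.
Proof.
move=> M_sym.
have Mxy : (y^T *m M *m x) 0 0 = (x^T *m M *m y) 0 0.
  have -> : y^T *m M *m x = (x^T *m M *m y)^T.
    by rewrite !trmx_mul trmxK -M_sym mulmxA.
  by rewrite mxE.
have -> : (midpoint x y)^T = 2^-1 *: (x^T + y^T).
  by apply/matrixP => i j; rewrite !mxE.
rewrite -scalemxAl mulmxA mulmxDl mulmxBr !mulmxDl.
have E (a b c d : 'M[R]_1) :
  (2^-1 *: (a + b - (c + d))) 0 0 = 2^-1 * (a 0 0 + b 0 0 - (c 0 0 + d 0 0)).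
  by rewrite !mxE.
by rewrite E Mxy; ring.
Qed.

(** Pairing the scheme with (z, e): the coupling through P exchanges energy
    between the two blocks without creating any, so only the input does work. *)
Lemma block_power_balance (R : realType) (nq ne nu : nat) (dt : R)
    (M : 'M[R]_nq) (Me : 'M[R]_ne) (P : 'M[R]_(nq, ne)) (J : 'M[R]_ne)
    (B : 'M[R]_(ne, nu)) (z dq : 'cV[R]_nq) (e de : 'cV[R]_ne) (u : 'cV[R]_nu) :
  J^T = - J ->
  block_mx M 0 0 Me *m col_mx dq de =
    dt *: (block_mx 0 P (- P^T) J *m col_mx z e) + dt *: (col_mx 0 B *m u) ->
  (e^T *m (Me *m de)) 0 0 + (z^T *m (M *m dq)) 0 0 =
  dt * ((B^T *m e)^T *m u) 0 0.
Proof.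
move=> J_skew; rewrite !mul_block_col mul_col_mx !scale_col_mx add_col_mx.
rewrite !mul0mx !(addr0, add0r) scaler0 addr0 => /eq_col_mx[-> ->].
rewrite !mulmxDr -!scalemxAr mulmxDr (mulmxA _ J) skew_quadratic_form0 // addr0.
have -> : e^T *m (- P^T *m z) = - (z^T *m (P *m e))^T.
  by rewrite !trmx_mul trmxK mulNmx mulmxN mulmxA.
rewrite (trmx_mul B^T) trmxK -mulmxA.
have entries (a b : 'M[R]_1) :
    (dt *: - a^T + dt *: b) 0 0 + (dt *: a) 0 0 = dt * b 0 0.
  by rewrite !mxE; ring.
exact: entries.
Qed.

(** * Partition of unity *)

Definition ramp (R : realType) (x : R) : R := Num.min 1 (Num.max 0 x).

(** The tent function rises over [-1, 0] like [ramp (x + 1)] and falls over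
    [0, 1] as [ramp x] is taken away. *)
Lemma hat_eq_ramp_diff (R : realType) (x : R) :
  Num.max 0 (1 - `|x|) = ramp (x + 1) - ramp x.
Proof.
rewrite /ramp.
case: (lerP 0 x) => [x0|x0]; [rewrite ger0_norm // | rewrite ltr0_norm //];
repeat (case: lerP => ?); lra.
Qed.

Lemma hat_sum1 (R : realType) (h s : R) (N : nat) :
  0 < h -> 0 <= s <= N%:R * h -> \sum_(i < N.+1) hat h i s = 1.
Proof.
move=> h0 /andP[s0 sN].
pose f (i : nat) := - ramp (s / h - i%:R + 1).
rewrite (eq_bigr (fun i : 'I_N.+1 => f i.+1 - f i)) => [|i _]; last first.
  rewrite /hat /f -[X in _ / X](gtr0_norm h0) -normf_div.
  rewrite mulrBl mulfK ?gt_eqF // hat_eq_ramp_diff -natr1.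
  have -> : s / h - (i%:R + 1) + 1 = s / h - i%:R by ring.
  by rewrite opprK [RHS]addrC.
rewrite -(big_mkord xpredT (fun i => f i.+1 - f i)) telescope_sumr // /f.
have t0 : 0 <= s / h by rewrite divr_ge0 // ltW.
have tN : s / h <= N%:R by rewrite ler_pdivrMr.
rewrite -natr1 /ramp.
by repeat (case: lerP => ?); lra.
Qed.

(** The elements are closed, so an interior node lies in two of them and the
    sum is 2 there: the nodes have to be excluded.  Away from them, the indicator
    of element j is the difference of the steps at its two ends. *)
Lemma element_indic_sum1 (R : realType) (h s : R) (N : nat) :
  0 < h -> 0 <= s <= N%:R * h -> (forall j : nat, s != j%:R * h) ->
  \sum_(j < N) element_indic h j s = 1.
Proof.
move=> h0 /andP[s0 sN] s_node.
pose f (j : nat) : R := - (j%:R * h <= s)%R%:R.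
rewrite (eq_bigr (fun j : 'I_N => f j.+1 - f j)) => [|j _]; last first.
  rewrite /element_indic /f indicE mem_setE in_itv /= opprK addrC.
  have jj : j%:R * h <= j.+1%:R * h by rewrite ler_pM2r // ler_nat.
  have [js|sj] /= := leP (j%:R * h) s; last first.
    by rewrite leNgt (lt_le_trans sj jj) /= subr0.
  by rewrite [_ <= s]leNgt lt_neqAle s_node /=; case: (s <= _); rewrite ?subrr ?subr0.
rewrite -(big_mkord xpredT (fun j => f j.+1 - f j)) telescope_sumr // /f.
have -> : (N%:R * h <= s) = false.
  by apply/negbTE; rewrite -ltNge lt_neqAle s_node.
by rewrite mul0r s0 opprK oppr0 add0r.
Qed.

Lemma fe_basis_sum1 (R : realType) (kind : fe_kind) (L : R) (N : nat) (s : R) :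
  0 < L -> (0 < N)%N -> 0 <= s <= L ->
  (forall j : nat, s != j%:R * (L / N%:R)) ->
  \sum_i fe_basis kind L N s 0 i = 1.
Proof.
move=> L0 N0 sL s_node.
have N0' : 0 < N%:R :> R by rewrite ltr0n.
have h0 : 0 < L / N%:R by rewrite divr_gt0.
have sN : 0 <= s <= N%:R * (L / N%:R) by rewrite mulrCA divff ?gt_eqF // mulr1.
case: kind => /=; under eq_bigr do rewrite mxE.
  exact: hat_sum1.
exact: element_indic_sum1.
Qed.

(** The exceptional set consists of the nodes, which are countably many. *)
Lemma fe_basis_sum1_ae (R : realType) (kind : fe_kind) (L : R) (N : nat) :
  0 < L -> (0 < N)%N ->
  {ae lebesgue_measure, forall s, `[0, L]%classic s ->
     \sum_i fe_basis kind L N s 0 i = 1}.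
Proof.
move=> L0 N0.
pose nodes := range (fun j : nat => j%:R * (L / N%:R) : R).
have nodes_countable : countable nodes by exact: card_image_le.
exists nodes; split.
- by apply: countable_measurable => // t; exact: measurable_set1.
- exact: countable_lebesgue_measure0.
- move=> s /= /not_implyP[sL sum_neq1]; apply: contrapT => s_node.
  apply: sum_neq1; apply: fe_basis_sum1 => //.
  by move=> j; apply/eqP => sj; apply: s_node; exists j.
Qed.

(** * Mass matrices and the gravity energy *)

Lemma fe_basis_ge0_le1 (R : realType) (kind : fe_kind) (L : R) (N : nat) (s : R) i :
  0 < L -> 0 <= fe_basis kind L N s 0 i <= 1.
Proof.
move=> L0; case: kind i => /= i; rewrite mxE.
  rewrite /hat le_max lexx /= ge_max ler01 gerBl divr_ge0 //.
  by rewrite divr_ge0 // ltW.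
by rewrite /element_indic indicE ler0n lern1 leq_b1.
Qed.

Lemma measurable_fe_basis (R : realType) (kind : fe_kind) (L : R) (N : nat)
    (D : set R) i :
  measurable D -> measurable_fun D (fun s => fe_basis kind L N s 0 i).
Proof.
move=> mD; apply: measurable_funTS; case: kind i => /= i.
  under eq_fun do rewrite mxE /hat.
  apply: measurable_maxr; first exact: measurable_cst.
  apply: measurable_funB; first exact: measurable_cst.
  apply: measurable_funM; last exact: measurable_cst.
  apply: measurableT_comp; first exact: normr_measurable.
  by apply: measurable_funB => //; exact: measurable_cst.
under eq_fun do rewrite mxE /element_indic.
by apply: measurable_indic; exact: measurable_itv.
Qed.

Lemma Rintegral_sum (d : measure_display) (T : measurableType d)
    (R : realType) (mu : {measure set T -> \bar R}) (D : set T)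
    (I : Type) (r : seq I) (f : I -> T -> R) :
  measurable D -> (forall i, mu.-integrable D (EFin \o f i)) ->
  \int[mu]_(x in D) (\sum_(i <- r) f i x) =
  \sum_(i <- r) \int[mu]_(x in D) f i x.
Proof.
move=> mD f_int; rewrite /Rintegral sum_fine; last first.
  by move=> i _; exact: integrable_fin_num (f_int i).
congr fine; rewrite -(integral_sum mD f_int).
by apply: eq_integral => x _; rewrite /= sumEFin.
Qed.

(** Row i of the product is the sum over l of the integrals of xi_i xi_l, that
    is, the integral of xi_i times the sum of the basis.  The bounds on xi make each
    xi_i xi_l integrable, so that sum and integral can be exchanged. *)
Lemma gram_mul_ones (R : realType) (n : nat) (D : set R) (xi : R -> 'rV[R]_n) :
  measurable D -> (lebesgue_measure D < +oo)%E ->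
  (forall i, measurable_fun D (fun s => xi s 0 i)) ->
  (forall i s, D s -> 0 <= xi s 0 i <= 1) ->
  {ae lebesgue_measure, forall s, D s -> \sum_i xi s 0 i = 1} ->
  mx_integral D (fun s => (xi s)^T *m xi s) *m const_mx 1 =
  mx_integral D (fun s => (xi s)^T) :> 'cV[R]_n.
Proof.
move=> mD Dfin mxi xi01 xi_sum1; apply/matrixP => i j; rewrite ord1 !mxE {j}.
have mxixi l : measurable_fun D (fun s => xi s 0 i * xi s 0 l).
  by apply: measurable_funM; exact: mxi.
have xixi_int l : (@lebesgue_measure R).-integrable D
    (EFin \o (fun s => xi s 0 i * xi s 0 l)).
  apply: measurable_bounded_integrable => //; first exact: mxixi.
  exists 1; split => // M M1 s Ds /=; apply: (le_trans _ (ltW M1)).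
  have /andP[a0 a1] := xi01 i s Ds; have /andP[b0 b1] := xi01 l s Ds.
  by rewrite ger0_norm ?mulr_ge0 // mulr_ile1.
under eq_bigr => l _.
  rewrite !mxE mulr1.
  have -> : (fun s => ((xi s)^T *m xi s) i l) = (fun s => xi s 0 i * xi s 0 l).
    by apply/funext => s; rewrite mxE big_ord1 mxE.
  over.
(* Lebesgue measure lives on [measurableTypeR R], not on the default
   measurable structure of R. *)
rewrite /= -(@Rintegral_sum _ (measurableTypeR R) R lebesgue_measure D
  _ _ _ mD xixi_int) /Rintegral; congr fine.
apply: ae_eq_integral => //.
- by apply/measurable_EFinP; apply: measurable_sum => l; exact: mxixi.
- by apply/measurable_EFinP; under eq_fun do rewrite mxE; exact: mxi.
apply: negligibleS xi_sum1; apply: subsetC => s sum1 Ds.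
by rewrite -mulr_sumr sum1 // mulr1 mxE.
Qed.

Lemma mass_r_mul_ones (R : realType) (b : beam R) :
  wf_beam b -> mass_r b *m const_mx 1 = avec_beam b.
Proof.
move=> [L0 N0]; apply: gram_mul_ones.
- exact: measurable_itv.
- by rewrite /Omega lebesgue_measure_itv /=; case: ifP => _; rewrite -?EFinB ltry.
- by move=> i; apply: measurable_fe_basis; exact: measurable_itv.
- by move=> i s _; exact: fe_basis_ge0_le1.
- exact: fe_basis_sum1_ae.
Qed.

Lemma tr_mass_r (R : realType) (b : beam R) : (mass_r b)^T = mass_r b.
Proof.
apply/matrixP => i j; rewrite !mxE; apply: eq_Rintegral => s _.
by rewrite !mxE; apply: eq_bigr => l _; rewrite !mxE mulrC.
Qed.

Lemma tr_avecE (R : realType) (k : nat) (bs : 'I_k -> beam R) :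
  (forall b, wf_beam (bs b)) -> (avec bs)^T = (const_mx 1)^T *m Mr bs.
Proof.
move=> bs_wf.
have Mr_sym : (Mr bs)^T = Mr bs.
  by rewrite /Mr tr_mxdiag; under eq_mxdiag do rewrite tr_mass_r.
rewrite -[Mr bs]Mr_sym -trmx_mul /Mr -mxcol_const mul_mxdiag_mxcol; congr trmx.
by apply: eq_mxcol => b; rewrite mass_r_mul_ones.
Qed.

(** The mass matrix in the scheme and the vector a in the energy weight the
    vertical displacement in the same way. *)
Lemma gravity_energy_diff (R : realType) (k : nat) (bs : 'I_k -> beam R)
    (rho A g : R) (q0 q1 : 'cV[R]_(dimQ bs)) :
  (forall b, wf_beam (bs b)) ->
  rho * g * A * ((avec bs)^T *m ry_of q1) 0 0 -
  rho * g * A * ((avec bs)^T *m ry_of q0) 0 0 =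
  ((zq bs rho A g)^T *m (Mq bs *m (q1 - q0))) 0 0.
Proof.
move=> bs_wf.
(* The row z^T is supported on the r_y-block. *)
have zM (dq : 'cV[R]_(dimQ bs)) :
    (zq bs rho A g)^T *m (Mq bs *m dq) =
    (rho * A * g) *: ((avec bs)^T *m ry_of dq).
  rewrite tr_avecE // /zq linearZ /= -scalemxAl; congr (_ *: _).
  rewrite /Mq /ry_of -[dq in LHS]vsubmxK -[usubmx dq in LHS]vsubmxK.
  rewrite !mul_block_col !tr_col_mx !mul_row_col !trmx0 !mul0mx.
  by rewrite !(addr0, add0r) mul_row_col mul0mx add0r mulmxA.
have scaleB (c : R) (a b : 'M[R]_1) : (c *: a - c *: b) 0 0 = c * (a 0 0 - b 0 0).
  by rewrite !mxE; ring.
rewrite !mulmxBr !zM scaleB; ring.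
Qed.

(** * Power balance of the scheme *)

Theorem proposition1 (R : realType)
    (k : nat) (k_gt0 : (0 < k)%N)
    (bs : 'I_k -> beam R) (bs_wf : forall b, wf_beam (bs b))
    (rho A g dt : R) (dt_gt0 : 0 < dt)
    (Me : 'M[R]_(dimE bs)) (Me_sympos : sympos Me)
    (Je : forall b : 'I_k, 'cV[R]_(dim_eb (bs b)) -> 'M[R]_(dim_eb (bs b)))
    (Je_skew : forall b eb, Je b eb = - (Je b eb)^T)
    (Jint : 'cV[R]_(dimTheta bs) -> 'M[R]_(dimE bs))
    (Jint_skew : forall theta, Jint theta = - (Jint theta)^T)
    (nu : nat) (Be : 'M[R]_(dimE bs, nu)) (u : 'cV[R]_nu)
    (q0 q1 : 'cV[R]_(dimQ bs)) (e0 e1 : 'cV[R]_(dimE bs))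
    (scheme : midpoint_scheme rho A g dt Me (Jmx Je Jint) Be u q0 e0 q1 e1) :
  (u = 0 -> energy rho A g Me q1 e1 = energy rho A g Me q0 e0) /\
  (energy rho A g Me q1 e1 - energy rho A g Me q0 e0) / dt
    = ((Be^T *m midpoint e0 e1)^T *m u) 0 0.
Proof.
have [Me_sym _] := Me_sympos.
set eh := midpoint e0 e1; set thetah := midpoint (theta_of q0) (theta_of q1).
have balance : energy rho A g Me q1 e1 - energy rho A g Me q0 e0 =
    dt * ((Be^T *m eh)^T *m u) 0 0.
  rewrite /energy opprD addrACA (quadratic_energy_diff _ _ Me_sym) -/eh.
  rewrite gravity_energy_diff //.
  exact: block_power_balance (Jmx_skew eh thetah Je_skew Jint_skew) scheme.
split=> [u0|]; last by rewrite balance mulrAC divff ?gt_eqF // mul1r.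
by apply/eqP; rewrite -subr_eq0 balance u0 mulmx0 mxE mulr0.
Qed.
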